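(* Let $\mathcal{B}\subseteq\omega^\omega$ be any mass problem. Let $n\geq1$ and let $f_1,\ldots,f_n\in\omega^\omega$ be pairwise Turing-incomparable such that $\{f_i\}\not\geq_M\mathcal{B}$ for every $i$. Then the interval of Medvedev degrees $$[\deg_M(\mathcal{B}\times\{f_1,\ldots,f_n\}),\ \deg_M(\mathcal{B}\times\{f_1\}'\times\cdots\times\{f_n\}')]$$ (ordered by $\leq_M$) is isomorphic to the Boolean algebra $\mathfrak{2}^n$ of all subsets of $\{0,\ldots,n-1\}$ under inclusion.
   Context: A mass problem is a subset of $\omega^\omega$. $\mathcal{A}\leq_M\mathcal{B}$ means there is a partial computable functional $\Psi$ defined on all of $\mathcal{B}$ with $\Psi(\mathcal{B})\subseteq\mathcal{A}$; $\deg_M(\mathcal{A})$ is the $\equiv_M$-equivalence class of $\mathcal{A}$, and the Medvedev lattice is the set of such degrees with the induced order. For $n\in\omega$, $n\,\widehat{\ }\,\mathcal{A}=\{n\,\widehat{\ }\,f:f\in\mathcal{A}\}$ and $\mathcal{A}\times\mathcal{B}=0\,\widehat{\ }\,\mathcal{A}\cup1\,\widehat{\ }\,\mathcal{B}$ (iterated finite products are taken in the evident way). For $f\in\omega^\omega$, $\{f\}'=\{m\,\widehat{\ }\,g: f<_T g\wedge\Phi_m(g)=f\}$, where $\Phi_m$ is the $m$-th partial computable functional. For degrees $\mathbf{a}\leq\mathbf{b}$, $[\mathbf{a},\mathbf{b}]=\{\mathbf{x}:\mathbf{a}\leq\mathbf{x}\leq\mathbf{b}\}$. *)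

(* Defs.v *)
From Stdlib Require Cantor.
From HB Require Import structures.
From mathcomp Require Import all_boot.
From mathcomp Require Import boolp classical_sets functions.

Set Implicit Arguments.
Unset Strict Implicit.
Unset Printing Implicit Defensive.

Local Open Scope classical_set_scope.

Definition baire := nat -> nat.

Definition npair (a b : nat) : nat := Cantor.to_nat (a, b).
Definition nfst (n : nat) : nat := (Cantor.of_nat n).1.
Definition nsnd (n : nat) : nat := (Cantor.of_nat n).2.

(* Kleene's partial recursive functions relative to an oracle, presented as
   unary functions; several arguments are passed through the bijection npair. *)
Inductive code : Type :=
  | CZero
  | CSucc
  | CFst
  | CSnd
  | COracle
  | CPair of code & code
  | CComp of code & code
  | CRec of code & code
  | CMu of code.

(* [eval g c x y]: with oracle g, program c halts on input x with output y.
   CRec c d sends <a, 0> to c(a) and <a, k+1> to d<a, <k, y>>, where y is its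
   value at <a, k>; CMu c sends a to the least m with c<a, m> = 0, provided
   c<a, k> converges for all k < m. *)
Fixpoint eval (g : baire) (c : code) : nat -> nat -> Prop :=
  match c with
  | CZero => fun _ y => y = 0
  | CSucc => fun x y => y = x.+1
  | CFst => fun x y => y = nfst x
  | CSnd => fun x y => y = nsnd x
  | COracle => fun x y => y = g x
  | CPair c d => fun x y =>
      exists y1 y2, [/\ eval g c x y1, eval g d x y2 & y = npair y1 y2]
  | CComp c d => fun x y => exists2 z, eval g d x z & eval g c z y
  | CRec c d => fun x =>
      (fix rec (k : nat) : nat -> Prop :=
         match k with
         | 0 => fun y => eval g c (nfst x) y
         | k.+1 => fun y =>
             exists2 z, rec k z & eval g d (npair (nfst x) (npair k z)) y
         end) (nsnd x)
  | CMu c => fun x y =>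
      eval g c (npair x y) 0 /\
      (forall k, k < y -> exists z, eval g c (npair x k) z.+1)
  end.

Fixpoint code_num (c : code) : nat :=
  match c with
  | CZero => npair 0 0
  | CSucc => npair 1 0
  | CFst => npair 2 0
  | CSnd => npair 3 0
  | COracle => npair 4 0
  | CPair c d => npair 5 (npair (code_num c) (code_num d))
  | CComp c d => npair 6 (npair (code_num c) (code_num d))
  | CRec c d => npair 7 (npair (code_num c) (code_num d))
  | CMu c => npair 8 (code_num c)
  end.

Lemma npair_inj a b a' b' : npair a b = npair a' b' -> a = a' /\ b = b'.
Proof. by move/Cantor.to_nat_inj => [-> ->]. Qed.

Lemma code_num_inj : injective code_num.
Proof.
elim=> [|||||c IHc d IHd|c IHc d IHd|c IHc d IHd|c IHc] [|||||c' d'|c' d'|c' d'|c'];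
  move=> /npair_inj[] // _.
- by case/npair_inj => /IHc -> /IHd ->.
- by case/npair_inj => /IHc -> /IHd ->.
- by case/npair_inj => /IHc -> /IHd ->.
- by move/IHc => ->.
Qed.

Lemma eval_functional g c x y y' : eval g c x y -> eval g c x y' -> y = y'.
Proof.
elim: c x y y' => [|||||c IHc d IHd|c IHc d IHd|c IHc d IHd|c IHc] x y y' /=;
  try by move=> -> ->.
- move=> [a [b [ca db ->]]] [a' [b' [ca' db' ->]]].
  by rewrite (IHc _ _ _ ca ca') (IHd _ _ _ db db').
- move=> [z dz cz] [z' dz' cz']; move: cz'.
  by rewrite -(IHd _ _ _ dz dz') => /(IHc _ _ _ cz).
- elim: (nsnd x) y y' => [|k IHk] y y'; first exact: IHc.
  move=> [z rz dz] [z' rz' dz']; move: dz'.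
  by rewrite -(IHk _ _ rz rz') => /(IHd _ _ _ dz).
- move=> [cy lty] [cy' lty'].
  case: (ltngtP y y') => // lt.
  + by have [z /IHc /(_ cy)] := lty' _ lt.
  + by have [z /IHc /(_ cy')] := lty _ lt.
Qed.

(* [Phi m g f]: the m-th partial computable functional is defined at g, with
   value f.  When m is not the number of a program, it is nowhere defined. *)
Definition Phi (m : nat) (g f : baire) : Prop :=
  exists2 c, code_num c = m & forall x, eval g c x (f x).

Definition turing_le (f g : baire) : Prop := exists m, Phi m g f.

Definition turing_lt (f g : baire) : Prop :=
  turing_le f g /\ ~ turing_le g f.

Definition turing_incomparable (f g : baire) : Prop :=
  ~ turing_le f g /\ ~ turing_le g f.

Definition mass_problem := set baire.

Definition medvedev_le (A B : mass_problem) : Prop :=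
  exists m, forall g, B g -> exists2 f, A f & Phi m g f.

Definition medvedev_equiv (A B : mass_problem) : Prop :=
  medvedev_le A B /\ medvedev_le B A.

Definition baire_cons (n : nat) (f : baire) : baire :=
  fun x => if x is k.+1 then f k else n.

Definition mass_prod (A B : mass_problem) : mass_problem :=
  (baire_cons 0 @` A) `|` (baire_cons 1 @` B).

(* A0 x A1 x ... x An, associated to the left *)
Definition mass_prods (A0 : mass_problem) (As : seq mass_problem) :
  mass_problem := foldl mass_prod A0 As.

Definition mass_jump (f : baire) : mass_problem :=
  [set h | exists m g, [/\ turing_lt f g, Phi m g f & h = baire_cons m g]].

Definition medvedev_deg (A : mass_problem) : set mass_problem :=
  [set X | medvedev_equiv X A].

Definition medvedev_degrees : set (set mass_problem) := range medvedev_deg.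

Definition deg_le (a b : set mass_problem) : Prop :=
  exists A B, [/\ a A, b B & medvedev_le A B].

Definition deg_interval (a b : set mass_problem) : set (set mass_problem) :=
  [set x | [/\ medvedev_degrees x, deg_le a x & deg_le x b]].

Definition order_isomorphic (T U : Type)
    (A : set T) (leA : T -> T -> Prop) (B : set U) (leB : U -> U -> Prop) :
  Prop :=
  exists phi : T -> U, set_bij A B phi /\
    (forall x y, A x -> A y -> (leA x y <-> leB (phi x) (phi y))).

(* Main.v *)
Require Import Defs.
From Stdlib Require Cantor.
From mathcomp Require Import all_boot.
From mathcomp Require Import boolp classical_sets functions.

Set Implicit Arguments.
Unset Strict Implicit.
Unset Printing Implicit Defensive.

Local Open Scope classical_set_scope.

(* For a set I of indices let M(I) be the product of B with {f_i}' for i in I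
   and {f_i} for i not in I.  Products are greatest lower bounds and
   {f} <= {f}' (run the given index on the given oracle, which takes a
   universal program), so M is monotone with values in the interval.  A product
   lies below a singleton {g} only if one of its factors does; if i is in I but
   not in J, then M(I) <= M(J) <= {f_i} would put B, or {f_j} with j <> i, or
   {f_i}' below {f_i}, and all three are impossible.  Hence M is an order
   embedding.

   It is onto: let X lie in the interval.  A reduction of the lower end to X
   splits X computably into a piece that B reduces to and pieces X_i that {f_i}
   reduces to; the f_i are told apart by finitely many values.  If f_i computes
   some element of X_i then X <= {f_i} <= X_i; otherwise every element of X_i
   lies strictly above f_i by one fixed index, so X <= {f_i}' <= X_i.  Gluing
   the pieces gives X = M(I), where I is the set of indices of the second
   kind. *)

Arguments npair : simpl never.
Arguments nfst : simpl never.
Arguments nsnd : simpl never.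

(** * Computable operators *)

Lemma nfst_npair a b : nfst (npair a b) = a.
Proof. by rewrite /nfst /npair Cantor.cancel_of_to. Qed.

Lemma nsnd_npair a b : nsnd (npair a b) = b.
Proof. by rewrite /nsnd /npair Cantor.cancel_of_to. Qed.

Definition npairK := (nfst_npair, nsnd_npair).

Lemma npair_eta x : npair (nfst x) (nsnd x) = x.
Proof.
by rewrite /npair /nfst /nsnd -surjective_pairing Cantor.cancel_to_of.
Qed.

Definition computes (c : code) (g f : baire) : Prop :=
  forall x, eval g c x (f x).

Definition computable (F : baire -> baire) : Prop :=
  exists c, forall g, computes c g (F g).

Lemma eq_computable F G : (forall g, F g =1 G g) ->
  computable F -> computable G.
Proof. by move=> FG [c cF]; exists c => g x; rewrite -FG; exact: cF. Qed.

Definition CId : code := CPair CFst CSnd.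

Lemma computes_CId g : computes CId g id.
Proof. by move=> x; exists (nfst x), (nsnd x); rewrite npair_eta. Qed.

Lemma computable_id : computable (fun _ x => x).
Proof. by exists CId => g; exact: computes_CId. Qed.

Lemma computable_comp F G : computable F -> computable G ->
  computable (fun g x => F g (G g x)).
Proof.
move=> [c cF] [d dG]; exists (CComp c d) => g x.
by exists (G g x); [exact: dG|exact: cF].
Qed.

Lemma computable_succ F : computable F -> computable (fun g x => (F g x).+1).
Proof. by apply: (@computable_comp (fun _ => S)); exists CSucc => g x. Qed.

Lemma computable_const n : computable (fun _ _ => n).
Proof.
elim: n => [|n IHn]; first by exists CZero.
exact: computable_succ IHn.
Qed.

Lemma computable_nfst F : computable F -> computable (fun g x => nfst (F g x)).
Proof. by apply: (@computable_comp (fun _ => nfst)); exists CFst => g x. Qed.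

Lemma computable_nsnd F : computable F -> computable (fun g x => nsnd (F g x)).
Proof. by apply: (@computable_comp (fun _ => nsnd)); exists CSnd => g x. Qed.

Lemma computable_oracle F : computable F -> computable (fun g x => g (F g x)).
Proof. by apply: (@computable_comp id); exists COracle => g x. Qed.

Lemma computable_npair F G : computable F -> computable G ->
  computable (fun g x => npair (F g x) (G g x)).
Proof.
move=> [c cF] [d dG]; exists (CPair c d) => g x.
by exists (F g x), (G g x); split; [exact: cF|exact: dG|].
Qed.

Lemma computable_iteri N A S : computable N -> computable A -> computable S ->
  computable (fun g x =>
    iteri (N g x) (fun k z => S g (npair x (npair k z))) (A g x)).
Proof.
move=> [n nN] [a aA] [s sS].
exists (CComp (CRec a s) (CPair CId n)) => g x.
exists (npair x (N g x)).
  by exists x, (N g x); split=> //; [exact: computes_CId|exact: nN].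
rewrite /= !npairK; elim: (N g x) => [|k IHk]; first exact: aA.
by eexists; [exact: IHk|exact: sS].
Qed.

Lemma computable_iter N A S : computable N -> computable A -> computable S ->
  computable (fun g x => iter (N g x) (S g) (A g x)).
Proof.
move=> N_comp A_comp S_comp.
apply: eq_computable (computable_iteri N_comp A_comp (computable_comp S_comp
  (computable_nsnd (computable_nsnd computable_id)))) => g x /=.
by elim: (N g x) => //= k ->; rewrite !npairK.
Qed.

Lemma computable_pred F : computable F -> computable (fun g x => (F g x).-1).
Proof.
move=> F_comp.
apply: eq_computable (computable_iteri F_comp (computable_const 0)
  (computable_nfst (computable_nsnd computable_id))) => g x.
by case: (F g x) => //= k; rewrite !npairK.
Qed.

Lemma computable_if0 F A B : computable F -> computable A -> computable B ->
  computable (fun g x => if F g x == 0 then A g x else B g x).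
Proof.
move=> F_comp A_comp B_comp.
apply: eq_computable (computable_iteri F_comp A_comp
  (computable_comp B_comp (computable_nfst computable_id))) => g x.
by case: (F g x) => //= k; rewrite !npairK.
Qed.

Lemma computable_nth_nil K : computable (fun g x => nth 0 [::] (K g x)).
Proof.
by apply: eq_computable (computable_const 0) => g x; rewrite nth_nil.
Qed.

Lemma computable_nth_cons K A L : computable K -> computable A ->
  computable (fun g x => nth 0 (L g x) (K g x).-1) ->
  computable (fun g x => nth 0 (A g x :: L g x) (K g x)).
Proof.
move=> K_comp A_comp L_comp.
apply: eq_computable (computable_if0 K_comp A_comp L_comp) => g x.
by case: (K g x).
Qed.

Ltac computability := repeat first
  [ exact: computable_const | exact: computable_id
  | apply: computable_nth_cons | exact: computable_nth_nil
  | apply: computable_if0 | apply: computable_npair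
  | apply: computable_nfst | apply: computable_nsnd
  | apply: computable_pred | apply: computable_succ
  | apply: computable_oracle ].

Lemma computable_nth s K : computable K ->
  computable (fun g x => nth 0 s (K g x)).
Proof.
elim: s K => [|a s IHs] K K_comp; first exact: computable_nth_nil.
apply: computable_nth_cons => //; first exact: computable_const.
exact: IHs (computable_pred K_comp).
Qed.

Lemma computable_if_eq n F A B :
  computable F -> computable A -> computable B ->
  computable (fun g x => if F g x == n then A g x else B g x).
Proof.
move=> + A_comp B_comp; elim: n F => [|n IHn] F F_comp.
  exact: computable_if0.
apply: eq_computable
  (computable_if0 F_comp B_comp (IHn _ (computable_pred F_comp))) => g x.
by case: (F g x).
Qed.

Lemma computable_index (s : seq nat) F : computable F ->
  computable (fun g x => index (F g x) s).
Proof.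
move=> F_comp; elim: s => [|n s IHs] /=; first exact: computable_const.
apply: eq_computable
  (computable_if_eq n F_comp (computable_const 0) (computable_succ IHs)) => g x.
by rewrite eq_sym.
Qed.

Lemma computable_search F : computable F -> exists c, forall g x k,
  F g (npair x k) = 0 -> exists2 m, eval g c x m & F g (npair x m) = 0.
Proof.
move=> [c cF]; exists (CMu c) => g x k Fk0.
have ex_zero : exists m, F g (npair x m) == 0 by exists k; rewrite Fk0.
case: (ex_minnP ex_zero) => m /eqP Fm0 m_min; exists m => //.
split=> [|j lt_jm]; first by rewrite -Fm0; exact: cF.
exists (F g (npair x j)).-1; rewrite prednK; first exact: cF.
by rewrite lt0n; apply: contraL lt_jm => /m_min; rewrite leqNgt.
Qed.

Definition baire_tail (g : baire) : baire := fun x => g x.+1.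

Lemma computable_tail : computable baire_tail.
Proof. by rewrite /baire_tail; computability. Qed.

Lemma computable_cons n : computable (baire_cons n).
Proof.
apply: (@eq_computable (fun g x => if x == 0 then n else g x.-1)).
  by move=> g [].
by computability.
Qed.

Fixpoint code_subst (d c : code) : code :=
  match c with
  | COracle => d
  | CPair c1 c2 => CPair (code_subst d c1) (code_subst d c2)
  | CComp c1 c2 => CComp (code_subst d c1) (code_subst d c2)
  | CRec c1 c2 => CRec (code_subst d c1) (code_subst d c2)
  | CMu c1 => CMu (code_subst d c1)
  | _ => c
  end.

Lemma eval_subst g h d c x y :
  computes d g h -> eval h c x y -> eval g (code_subst d c) x y.
Proof.
move=> dh.
elim: c x y => [|||||c IHc e IHe|c IHc e IHe|c IHc e IHe|c IHc] x y //=.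
- by move=> ->.
- by move=> [a [b [/IHc ca /IHe eb ->]]]; exists a, b.
- by move=> [z /IHe ez /IHc cz]; exists z.
- elim: (nsnd x) y => [|k IHk] y; first exact: IHc.
  by move=> [z /IHk rz /IHe ez]; exists z.
- by move=> [/IHc c0 lt]; split=> // k /lt[z /IHc cz]; exists z.
Qed.

Lemma computes_subst f g h c d :
  computes d g h -> computes c h f -> computes (code_subst d c) g f.
Proof. by move=> dh cf x; exact: eval_subst dh (cf x). Qed.

(** * A universal program *)

(* Programs are run by a machine whose state pairs a stack of frames (0 is the
   empty stack) with the current value.  A frame with tag at most 8 is the
   number of a program to be applied to the current value; the remaining four
   kinds of frames are continuations of CPair, CRec and CMu. *)
Definition push (t K : nat) : nat := (npair t K).+1.

Definition fst_frame (d x : nat) : nat := npair 9 (npair d x).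

Definition snd_frame (a : nat) : nat := npair 10 a.

(* The current value is that of the recursion at <a, k>; r steps remain. *)
Definition rec_frame (d a k r : nat) : nat :=
  npair 11 (npair d (npair a (npair k r))).

(* The current value is that of c at <x, k>. *)
Definition mu_frame (c x k : nat) : nat := npair 12 (npair c (npair x k)).

Definition action (g : baire) (t d K v : nat) : nat :=
  nth 0
  [:: npair K 0;
      npair K v.+1;
      npair K (nfst v);
      npair K (nsnd v);
      npair K (g v);
      npair (push (nfst d) (push (fst_frame (nsnd d) v) K)) v;
      npair (push (nsnd d) (push (nfst d) K)) v;
      npair (push (nfst d) (push (rec_frame (nsnd d) (nfst v) 0 (nsnd v)) K))
        (nfst v);
      npair (push d (push (mu_frame d v 0) K)) (npair v 0);
      npair (push (nfst d) (push (snd_frame v) K)) (nsnd d);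
      npair K (npair d v);
      (let e := nfst d in let a := nfst (nsnd d) in
       let k := nfst (nsnd (nsnd d)) in let r := nsnd (nsnd (nsnd d)) in
       if r == 0 then npair K v else
       npair (push e (push (rec_frame e a k.+1 r.-1) K))
         (npair a (npair k v)));
      (let c := nfst d in let x := nfst (nsnd d) in let k := nsnd (nsnd d) in
       if v == 0 then npair K k else
       npair (push c (push (mu_frame c x k.+1) K)) (npair x k.+1))] t.

Definition step (g : baire) (s : nat) : nat :=
  if nfst s == 0 then s else
  let t := nfst (nfst s).-1 in
  action g (nfst t) (nsnd t) (nsnd (nfst s).-1) (nsnd s).

Lemma stepE g t d K v :
  step g (npair (push (npair t d) K) v) = action g t d K v.
Proof. by rewrite /step nfst_npair /push /= !npairK. Qed.

Lemma computable_step : computable step.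
Proof.
rewrite /step /action /push /fst_frame /snd_frame /rec_frame /mu_frame.
by computability.
Qed.

Definition reach (g : baire) (s s' : nat) : Prop :=
  exists k, iter k (step g) s = s'.

Lemma reach_refl g s : reach g s s.
Proof. by exists 0. Qed.

Lemma reach_trans g s1 s2 s3 : reach g s1 s2 -> reach g s2 s3 -> reach g s1 s3.
Proof. by move=> [k <-] [l <-]; exists (l + k); rewrite iterD. Qed.

Lemma reach_step g s s' : reach g (step g s) s' -> reach g s s'.
Proof. by move=> [k <-]; exists k.+1; rewrite iterSr. Qed.

Ltac machine_step := apply: reach_step; rewrite stepE /action /= ?npairK /=.

Definition simulated (g : baire) (c : code) : Prop := forall x y K,
  eval g c x y -> reach g (npair (push (code_num c) K) x) (npair K y).

Lemma simulated_CPair g c d :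
  simulated g c -> simulated g d -> simulated g (CPair c d).
Proof.
move=> c_sim d_sim x _ K [a [b [ca db ->]]]; machine_step.
apply: reach_trans (c_sim _ _ _ ca) _; machine_step.
apply: reach_trans (d_sim _ _ _ db) _; machine_step.
exact: reach_refl.
Qed.

Lemma simulated_CComp g c d :
  simulated g c -> simulated g d -> simulated g (CComp c d).
Proof.
move=> c_sim d_sim x y K [z dz cz]; machine_step.
exact: reach_trans (d_sim _ _ _ dz) (c_sim _ _ _ cz).
Qed.

Lemma eval_CRec0 g c d a y : eval g (CRec c d) (npair a 0) y = eval g c a y.
Proof. by rewrite /= !npairK. Qed.

Lemma eval_CRecS g c d a k y : eval g (CRec c d) (npair a k.+1) y =
  (exists2 z, eval g (CRec c d) (npair a k) z
            & eval g d (npair a (npair k z)) y).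
Proof. by rewrite /= !npairK. Qed.

Lemma reach_rec_frame g c d a k r z K : simulated g c -> simulated g d ->
  eval g (CRec c d) (npair a k) z ->
  reach g
    (npair (push (code_num c) (push (rec_frame (code_num d) a 0 (k + r)) K)) a)
    (npair (push (rec_frame (code_num d) a k r) K) z).
Proof.
move=> c_sim d_sim; elim: k r z => [|k IHk] r z.
  by rewrite eval_CRec0; exact: c_sim.
rewrite eval_CRecS => -[w /(IHk r.+1) reach_k dz]; rewrite addSnnS.
apply: reach_trans reach_k _; machine_step.
exact: d_sim.
Qed.

Lemma simulated_CRec g c d :
  simulated g c -> simulated g d -> simulated g (CRec c d).
Proof.
move=> c_sim d_sim x y K; rewrite -{1}[x]npair_eta.
move=> /(reach_rec_frame 0 K c_sim d_sim); rewrite addn0 => reach_end.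
machine_step; apply: reach_trans reach_end _; machine_step.
exact: reach_refl.
Qed.

Lemma reach_mu_frame g c x m K : simulated g c ->
  (forall k, k < m -> exists z, eval g c (npair x k) z.+1) ->
  reach g
    (npair (push (code_num c) (push (mu_frame (code_num c) x 0) K)) (npair x 0))
    (npair (push (code_num c) (push (mu_frame (code_num c) x m) K))
      (npair x m)).
Proof.
move=> c_sim; elim: m => [|m IHm] nonzero; first exact: reach_refl.
apply: reach_trans (IHm _) _ => [k /ltnW|]; first exact: nonzero.
have [z cz] := nonzero m (ltnSn m).
apply: reach_trans (c_sim _ _ _ cz) _; machine_step.
exact: reach_refl.
Qed.

Lemma simulated_CMu g c : simulated g c -> simulated g (CMu c).
Proof.
move=> c_sim x y K [c0 nonzero]; machine_step.
apply: reach_trans (reach_mu_frame K c_sim nonzero) _.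
apply: reach_trans (c_sim _ _ _ c0) _; machine_step.
exact: reach_refl.
Qed.

Lemma simulated_code g c : simulated g c.
Proof.
elim: c => [|||||c IHc d IHd|c IHc d IHd|c IHc d IHd|c IHc];
  try by move=> x y K /= ->; machine_step; exact: reach_refl.
- exact: simulated_CPair.
- exact: simulated_CComp.
- exact: simulated_CRec.
- exact: simulated_CMu.
Qed.

Definition run (g : baire) (w k : nat) : nat :=
  iter k (step g) (npair (push (nfst w) 0) (nsnd w)).

Lemma computable_run : computable (fun g z => run g (nfst z) (nsnd z)).
Proof.
rewrite /run /push; apply: computable_iter; last exact: computable_step.
- by computability.
- by computability.
Qed.

Lemma run_eval g c x y : eval g c x y ->
  exists k, run g (npair (code_num c) x) k = npair 0 y.
Proof. by move=> /(simulated_code 0); rewrite /reach /run !npairK. Qed.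

Lemma run_halted_uniq g w j k :
  nfst (run g w j) = 0 -> nfst (run g w k) = 0 -> run g w j = run g w k.
Proof.
wlog le_jk : j k / j <= k => [thesis jhalt khalt|jhalt _].
  by case: (leqP j k) => [|/ltnW] le; [|symmetry]; exact: thesis.
rewrite -(subnK le_jk); elim: (k - j) => //= i.
by rewrite -/(run g w _) => <-; rewrite /step jhalt.
Qed.

Lemma universal_code : exists u, forall g c x y,
  eval g c x y -> eval g u (npair (code_num c) x) y.
Proof.
have [halt_search searchP] :=
  computable_search (computable_nfst computable_run).
have [output outputP] := computable_nsnd computable_run.
exists (CComp output (CPair CId halt_search)) => g c x y /run_eval[k run_k].
set w := npair _ x in run_k *.
have khalt : nfst (run g w k) = 0 by rewrite run_k npairK.
have [|m search_m] := searchP g w k; first by rewrite !npairK.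
rewrite !npairK => mhalt.
exists (npair w m); first by exists w, m; split=> //; exact: computes_CId.
have := outputP g (npair w m).
by rewrite !npairK (run_halted_uniq mhalt khalt) run_k npairK.
Qed.

(** * Turing and Medvedev reducibility *)

Lemma turing_leP f g : turing_le f g <-> exists c, computes c g f.
Proof.
split=> [[m [c _ cf]]|[c cf]]; first by exists c.
by exists (code_num c), c.
Qed.

Lemma turing_le_refl f : turing_le f f.
Proof. by apply/turing_leP; exists COracle => x. Qed.

Lemma turing_le_trans f g h : turing_le f g -> turing_le g h -> turing_le f h.
Proof.
move=> /turing_leP[c cf] /turing_leP[d dg]; apply/turing_leP.
by exists (code_subst d c); exact: computes_subst dg cf.
Qed.

Lemma turing_le_cons n f : turing_le f (baire_cons n f).
Proof.
have [c tail_c] := computable_tail.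
by apply/turing_leP; exists c; exact: tail_c.
Qed.

Lemma medvedev_leP A B : medvedev_le A B <->
  exists c, forall g, B g -> exists2 f, A f & computes c g f.
Proof.
split=> [[m mA]|[c cA]]; last first.
  by exists (code_num c) => g /cA[f Af cf]; exists f => //; exists c.
have [[c c_num]|no_code] := pselect (exists c, code_num c = m).
  exists c => g /mA[f Af [d d_num df]]; exists f => //.
  by have -> : c = d by apply: code_num_inj; rewrite c_num d_num.
by exists CZero => g /mA[f Af [d d_num _]]; case: no_code; exists d.
Qed.

Lemma medvedev_le_subset A B : B `<=` A -> medvedev_le A B.
Proof. by move=> BA; apply/medvedev_leP; exists COracle => g /BA; exists g. Qed.

Lemma medvedev_le_refl A : medvedev_le A A.
Proof. exact: medvedev_le_subset. Qed.

Lemma medvedev_le_trans A B C :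
  medvedev_le A B -> medvedev_le B C -> medvedev_le A C.
Proof.
move=> /medvedev_leP[c cA] /medvedev_leP[d dB]; apply/medvedev_leP.
exists (code_subst d c) => g /dB[h /cA[f Af cf] dh]; exists f => //.
exact: computes_subst dh cf.
Qed.

Lemma medvedev_le_computable F A B : computable F ->
  (forall g, B g -> A (F g)) -> medvedev_le A B.
Proof.
by move=> [c cF] BA; apply/medvedev_leP; exists c => g /BA; exists (F g).
Qed.

Lemma medvedev_le_set1P A g :
  medvedev_le A [set g] <-> exists2 f, A f & turing_le f g.
Proof.
split=> [/medvedev_leP[c /(_ g erefl)[f Af cf]]|[f Af /turing_leP[c cf]]].
  by exists f => //; apply/turing_leP; exists c.
by apply/medvedev_leP; exists c => _ ->; exists f.
Qed.

(* The code of a cover computes the index of some piece containing the oracle;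
   no piece needs to be decidable and pieces may overlap. *)
Definition computable_cover N (X : mass_problem) (P : 'I_N -> mass_problem) :
  Prop :=
  exists q, forall g, X g -> exists2 i, P i g & eval g q 0 (val i).

(* The universal program lets the computed index select among finitely many
   reductions without running the ones that were not selected. *)
Lemma medvedev_le_cover N (P : 'I_N -> mass_problem) X C :
  computable_cover X P -> (forall i, medvedev_le C (P i)) -> medvedev_le C X.
Proof.
move=> [q qP] CP.
have /choice[d dC] i :
    exists d, forall g, P i g -> exists2 f, C f & computes d g f.
  exact/medvedev_leP.
have [u univ] := universal_code.
have [t tableP] :=
  computable_nth [seq code_num (d i) | i <- enum 'I_N] computable_id.
apply/medvedev_leP.
exists (CComp u (CPair (CComp t (CComp q CZero)) CId)) => g /qP[i Pig qi].
have [f Cf df] := dC i g Pig; exists f => // x.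
exists (npair (code_num (d i)) x); last exact: univ.
exists (code_num (d i)), x; split=> //; last exact: computes_CId.
exists (val i); first by exists 0.
by have := tableP g i; rewrite (nth_map i) ?size_enum_ord // nth_ord_enum.
Qed.

Lemma computable_cover_pullback N (P : 'I_N -> mass_problem) Y X :
  computable_cover Y P -> medvedev_le Y X ->
  exists Q : 'I_N -> mass_problem,
    [/\ computable_cover X Q, forall i, Q i `<=` X
      & forall i, medvedev_le (P i) (Q i)].
Proof.
move=> [q qP] /medvedev_leP[c cY].
exists (fun i => [set g | X g /\ exists2 f, P i f & computes c g f]).
split=> [|i g []//|i].
  exists (code_subst c q) => g Xg; have [f /qP[i Pif qi] cf] := cY g Xg.
  by exists i; [split=> //; exists f|exact: eval_subst cf qi].
by apply/medvedev_leP; exists c => g [].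
Qed.

Definition sample (zs : seq nat) (g : baire) : nat :=
  foldr (fun z a => npair (g z) a) 0 zs.

Lemma computable_sample zs : computable (fun g _ => sample zs g).
Proof.
elim: zs => [|z zs IHzs] /=; first exact: computable_const.
by apply: computable_npair => //; computability.
Qed.

Lemma sample_inj zs g h : sample zs g = sample zs h -> {in zs, g =1 h}.
Proof.
elim: zs => [//|z zs IHzs] /= /npair_inj[eq_z /IHzs eq_zs] y.
by rewrite inE => /predU1P[->|/eq_zs].
Qed.

Lemma separating_sample (I : finType) (f : I -> baire) : injective f ->
  exists zs, injective (fun i => sample zs (f i)).
Proof.
move=> f_inj.
have /choice[z sep_z] (p : I * I) :
    exists z, p.1 <> p.2 -> f p.1 z <> f p.2 z.
  have [->|/eqP neq] := eqVneq p.1 p.2; first by exists 0.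
  have /existsNP[z neq_z] : ~ f p.1 =1 f p.2 by move=> /funext/f_inj.
  by exists z.
exists (codom z) => i j /sample_inj eq_ij; apply: contrapT => neq_ij.
exact: (sep_z (i, j)) neq_ij (eq_ij _ (codom_f z (i, j))).
Qed.

Lemma computable_cover_range n (f : 'I_n -> baire) : injective f ->
  computable_cover (range f) (fun i => [set f i]).
Proof.
move=> /separating_sample[zs zs_inj].
have [q indexP] := computable_index
  [seq sample zs (f i) | i <- enum 'I_n] (computable_sample zs).
exists q => _ [i _ <-]; exists i => //.
by have := indexP (f i) 0; rewrite (index_map zs_inj) index_enum_ord.
Qed.

(** * Products and jumps *)

Lemma medvedev_le_cons n A : medvedev_le A (baire_cons n @` A).
Proof.
by apply: medvedev_le_computable computable_tail _ => _ [g Ag <-].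
Qed.

Lemma mass_prod_lel A B : medvedev_le (mass_prod A B) A.
Proof.
by apply: medvedev_le_computable (computable_cons 0) _ => g Ag; left; exists g.
Qed.

Lemma mass_prod_ler A B : medvedev_le (mass_prod A B) B.
Proof.
by apply: medvedev_le_computable (computable_cons 1) _ => g Bg; right; exists g.
Qed.

Lemma computable_cover_mass_prod A B : computable_cover (mass_prod A B)
  (fun k : 'I_2 => baire_cons k @` (if k == ord0 then A else B)).
Proof.
exists COracle => _ [[g Ag <-]|[g Bg <-]].
- by exists ord0 => //; exists g.
- by exists ord_max => //; exists g.
Qed.

Lemma mass_prod_glb A B C :
  medvedev_le C A -> medvedev_le C B -> medvedev_le C (mass_prod A B).
Proof.
move=> CA CB; apply: medvedev_le_cover (computable_cover_mass_prod A B) _ => k.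
by apply: medvedev_le_trans (medvedev_le_cons _ _); case: ifP.
Qed.

Lemma mass_prod_le_split A B X : medvedev_le (mass_prod A B) X ->
  exists Y Z, [/\ Y `<=` X, Z `<=` X, medvedev_le A Y, medvedev_le B Z
    & forall C, medvedev_le C Y -> medvedev_le C Z -> medvedev_le C X].
Proof.
move=> /(computable_cover_pullback (computable_cover_mass_prod A B)).
move=> [P [P_cover PX P_ge]]; exists (P ord0), (P ord_max); split=> //.
- exact: medvedev_le_trans (medvedev_le_cons 0 A) (P_ge ord0).
- exact: medvedev_le_trans (medvedev_le_cons 1 B) (P_ge ord_max).
move=> C CY CZ; apply: medvedev_le_cover P_cover _ => k.
have [->//|k_neq0] := eqVneq k ord0.
by have -> : k = ord_max by apply: val_inj; case: k k_neq0 => [[|[]]].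
Qed.

Lemma mass_prod_le_set1 A B g : medvedev_le (mass_prod A B) [set g] ->
  medvedev_le A [set g] \/ medvedev_le B [set g].
Proof.
move=> /medvedev_le_set1P[_ [[f fin <-]|[f fin <-]] le]; [left|right];
  apply/medvedev_le_set1P; exists f => //.
- exact: turing_le_trans (turing_le_cons _ _) le.
- exact: turing_le_trans (turing_le_cons _ _) le.
Qed.

Lemma mass_prods_le_head A0 As : medvedev_le (mass_prods A0 As) A0.
Proof.
elim: As A0 => [|A As IHAs] A0 /=; first exact: medvedev_le_refl.
exact: medvedev_le_trans (IHAs _) (mass_prod_lel _ _).
Qed.

Section MassProds.
Variables (I : eqType) (F : I -> mass_problem).
Implicit Type s : seq I.

Lemma mass_prods_le A0 s i : i \in s ->
  medvedev_le (mass_prods A0 [seq F j | j <- s]) (F i).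
Proof.
elim: s A0 => [//|j s IHs] A0; rewrite inE => /predU1P[->|/IHs]; last exact.
exact: medvedev_le_trans (mass_prods_le_head _ _) (mass_prod_ler _ _).
Qed.

Lemma mass_prods_glb A0 s C :
  medvedev_le C A0 -> (forall i, i \in s -> medvedev_le C (F i)) ->
  medvedev_le C (mass_prods A0 [seq F j | j <- s]).
Proof.
elim: s A0 => [//|j s IHs] A0 CA0 CF /=; apply: IHs => [|i si].
- by apply: mass_prod_glb => //; apply: CF; rewrite mem_head.
- by apply: CF; rewrite inE si orbT.
Qed.

Lemma mass_prods_le_set1 A0 s g :
  medvedev_le (mass_prods A0 [seq F j | j <- s]) [set g] ->
  medvedev_le A0 [set g] \/ exists2 i, i \in s & medvedev_le (F i) [set g].
Proof.
elim: s A0 => [|j s IHs] A0 /=; first by left.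
case/IHs => [/mass_prod_le_set1[le|le]|[i si le]].
- by left.
- by right; exists j; rewrite ?mem_head.
- by right; exists i; rewrite // inE si orbT.
Qed.

End MassProds.

Lemma set1_le_mass_jump f : medvedev_le [set f] (mass_jump f).
Proof.
have [u univ] := universal_code; have [d tail_d] := computable_tail.
apply/medvedev_leP.
exists (CComp (code_subst d u) (CPair (CComp COracle CZero) CId)).
move=> _ [m [g [_ [c <- cf] ->]]]; exists f => // x.
exists (npair (code_num c) x).
  exists (code_num c), x; split=> //; last exact: computes_CId.
  by exists 0.
exact: eval_subst (tail_d _) (univ _ _ _ _ (cf x)).
Qed.

Lemma mass_jump_le_set1 f g :
  medvedev_le (mass_jump f) [set g] -> turing_lt f g.
Proof.
move=> /medvedev_le_set1P[_ [m [h [[le_fh nle_hf] _ ->]]] le].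
have le_hg := turing_le_trans (turing_le_cons _ _) le.
split; first exact: turing_le_trans le_fh le_hg.
by move=> le_gf; apply: nle_hf; exact: turing_le_trans le_hg le_gf.
Qed.

Lemma mass_jump_le f X : medvedev_le [set f] X ->
  (forall h, X h -> ~ turing_le h f) -> medvedev_le (mass_jump f) X.
Proof.
move=> /medvedev_leP[c cX] X_nle.
apply: medvedev_le_computable (computable_cons (code_num c)) _ => h Xh.
have [_ -> cf] := cX h Xh.
exists (code_num c), h; split=> //; last by exists c.
by split; [apply/turing_leP; exists c|exact: X_nle].
Qed.

Definition jump_if (b : bool) (f : baire) : mass_problem :=
  if b then mass_jump f else [set f].

Lemma jump_if_mono b b' f : b ==> b' ->
  medvedev_le (jump_if b f) (jump_if b' f).
Proof.
by case: b b' => [] [] // _;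
  [exact: medvedev_le_refl|exact: set1_le_mass_jump|exact: medvedev_le_refl].
Qed.

Lemma jump_if_le_set1 b f g : medvedev_le (jump_if b f) [set g] ->
  turing_le f g /\ (b -> ~ turing_le g f).
Proof.
by case: b => [/mass_jump_le_set1[]|/medvedev_le_set1P[_ -> ]].
Qed.

Lemma jump_if_interpolation f X Y : Y `<=` X ->
  medvedev_le [set f] Y -> medvedev_le X (mass_jump f) ->
  exists b, medvedev_le X (jump_if b f) /\ medvedev_le (jump_if b f) Y.
Proof.
move=> YX fY Xf.
have [[h Yh le_hf]|none] := pselect (exists2 h, Y h & turing_le h f).
  exists false; split=> //.
  by apply/medvedev_le_set1P; exists h => //; exact: YX.
exists true; split=> //; apply: mass_jump_le fY _ => h Yh le_hf.
by apply: none; exists h.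
Qed.

Section JumpProd.
Variables (B : mass_problem) (n : nat) (f : 'I_n -> baire).
Implicit Types (I J : {set 'I_n}) (X C : mass_problem).

Definition jump_prod I : mass_problem :=
  mass_prods B [seq jump_if (i \in I) (f i) | i <- enum 'I_n].

Lemma jump_prod_setT :
  jump_prod [set: 'I_n] = mass_prods B [seq mass_jump (f i) | i <- enum 'I_n].
Proof. by congr mass_prods; apply: eq_map => i; rewrite finset.in_setT. Qed.

Lemma jump_prod_le_base I : medvedev_le (jump_prod I) B.
Proof. exact: mass_prods_le_head. Qed.

Lemma jump_prod_le I i : medvedev_le (jump_prod I) (jump_if (i \in I) (f i)).
Proof.
apply: (mass_prods_le (fun i => jump_if (i \in I) (f i))).
exact: mem_enum.
Qed.

Lemma jump_prod_glb I C : medvedev_le C B ->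
  (forall i, medvedev_le C (jump_if (i \in I) (f i))) ->
  medvedev_le C (jump_prod I).
Proof. by move=> CB Cf; exact: mass_prods_glb. Qed.

Lemma jump_prod_mono I J : I \subset J ->
  medvedev_le (jump_prod I) (jump_prod J).
Proof.
move=> /fintype.subsetP sIJ; apply: jump_prod_glb => [|i].
  exact: jump_prod_le_base.
apply: medvedev_le_trans (jump_prod_le I i) (jump_if_mono _ _).
exact/implyP/sIJ.
Qed.

Lemma mass_prod_le_jump_prod I :
  medvedev_le (mass_prod B (range f)) (jump_prod I).
Proof.
apply: jump_prod_glb => [|i]; first exact: mass_prod_lel.
apply: medvedev_le_trans (mass_prod_ler _ _) _.
apply: medvedev_le_trans (jump_if_mono (b := false) _ isT).
by apply: medvedev_le_subset => _ ->; exists i.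
Qed.

Lemma jump_prod_subset I J :
  (forall i j : 'I_n, i <> j -> ~ turing_le (f i) (f j)) ->
  (forall i : 'I_n, ~ medvedev_le B [set f i]) ->
  medvedev_le (jump_prod I) (jump_prod J) -> I \subset J.
Proof.
move=> f_nle B_nle le_IJ; apply/fintype.subsetP => i iI.
apply: contrapT => /negP iJ.
have := medvedev_le_trans le_IJ (jump_prod_le J i); rewrite (negbTE iJ).
case/mass_prods_le_set1 => [/B_nle //|[j _ /jump_if_le_set1[le_ji nle_ij]]].
have [eq_ji|/f_nle/(_ le_ji) //] := pselect (j = i).
by apply: nle_ij; rewrite eq_ji //; exact: turing_le_refl.
Qed.

Lemma jump_prod_surjective X : injective f ->
  medvedev_le (mass_prod B (range f)) X ->
  medvedev_le X (jump_prod [set: 'I_n]) ->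
  exists I, medvedev_equiv X (jump_prod I).
Proof.
move=> f_inj /mass_prod_le_split[Y [Y' [_ Y'X BY fY' glue]]] X_le.
have [Z [Z_cover ZY' Z_ge]] :=
  computable_cover_pullback (computable_cover_range f_inj) fY'.
have /choice[jumps jumpsP] i : exists b,
    medvedev_le X (jump_if b (f i)) /\ medvedev_le (jump_if b (f i)) (Z i).
  apply: jump_if_interpolation (Z_ge i) _.
    exact: subset_trans (ZY' i) Y'X.
  by have := medvedev_le_trans X_le (jump_prod_le _ i); rewrite finset.in_setT.
pose I := finset jumps.
have I_jumps i : (i \in I) = jumps i by rewrite finset.inE.
exists I; split.
  apply: jump_prod_glb => [|i]; last by rewrite I_jumps; case: (jumpsP i).
  exact: medvedev_le_trans X_le (jump_prod_le_base _).
apply: glue; first exact: medvedev_le_trans (jump_prod_le_base _) BY.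
apply: medvedev_le_cover Z_cover _ => i.
apply: medvedev_le_trans (jump_prod_le I i) _.
by rewrite I_jumps; case: (jumpsP i).
Qed.

End JumpProd.

(** * Intervals of Medvedev degrees *)

Lemma medvedev_degP A B :
  medvedev_deg A = medvedev_deg B <-> medvedev_equiv A B.
Proof.
split=> [eq_deg|[AB BA]].
  have : medvedev_deg A A by split; exact: medvedev_le_refl.
  by rewrite eq_deg.
apply/seteqP; split=> X [XA AX]; split.
- exact: medvedev_le_trans XA AB.
- exact: medvedev_le_trans BA AX.
- exact: medvedev_le_trans XA BA.
- exact: medvedev_le_trans AB AX.
Qed.

Lemma deg_leP A B :
  deg_le (medvedev_deg A) (medvedev_deg B) <-> medvedev_le A B.
Proof.
split=> [[X [Y [[_ AX] [YB _] XY]]]|AB].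
  exact: medvedev_le_trans AX (medvedev_le_trans XY YB).
by exists A, B; split=> //; split; exact: medvedev_le_refl.
Qed.

Lemma deg_interval_isomorphic (T : Type) (leT : T -> T -> Prop) (t0 : T)
    (M : T -> mass_problem) L U :
  (forall s t, leT s t -> leT t s -> s = t) ->
  (forall s t, medvedev_le (M s) (M t) <-> leT s t) ->
  (forall t, medvedev_le L (M t) /\ medvedev_le (M t) U) ->
  (forall X, medvedev_le L X -> medvedev_le X U ->
    exists t, medvedev_equiv X (M t)) ->
  order_isomorphic (deg_interval (medvedev_deg L) (medvedev_deg U)) deg_le
    [set: T] leT.
Proof.
move=> leT_anti leM M_in M_onto; set interval := deg_interval _ _.
have M_interval t : interval (medvedev_deg (M t)).
  by have [LM MU] := M_in t; split; [exists (M t)|exact/deg_leP|exact/deg_leP].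
have /choice[phi phiP] x :
    exists t, interval x -> x = medvedev_deg (M t).
  have [[[X _ <-] /deg_leP LX /deg_leP XU]|] := pselect (interval x).
    by have [t Xt] := M_onto X LX XU; exists t => _; apply/medvedev_degP.
  by exists t0.
exists phi; split=> [|x y /phiP {1}-> /phiP {1}->]; last by rewrite deg_leP.
split=> // [x y /set_mem /phiP {2}-> /set_mem /phiP {2}-> -> //|t _].
exists (medvedev_deg (M t)) => //.
by have /phiP/medvedev_degP[/leM le /leM ge] := M_interval t; exact: leT_anti.
Qed.

Theorem theorem2p8 (B : mass_problem) (n : nat) (f : 'I_n -> baire)
  (hn : 1 <= n)
  (hinc : forall i j : 'I_n, i <> j -> turing_incomparable (f i) (f j))
  (hB : forall i : 'I_n, ~ medvedev_le B [set f i]) :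
  order_isomorphic
    (deg_interval
       (medvedev_deg (mass_prod B (range f)))
       (medvedev_deg (mass_prods B [seq mass_jump (f i) | i <- enum 'I_n])))
    deg_le
    [set: {set 'I_n}] (fun I J : {set 'I_n} => I \subset J).
Proof.
have f_nle i j : i <> j -> ~ turing_le (f i) (f j) by move=> /hinc[].
have f_inj : injective f.
  by move=> i j eq_f; apply: contrapT => /f_nle; apply; rewrite eq_f;
    exact: turing_le_refl.
rewrite -jump_prod_setT.
apply: (deg_interval_isomorphic finset.set0 (M := jump_prod B f))
  => [I J|I J|I|X].
- by move=> sIJ sJI; apply/eqP; rewrite finset.eqEsubset sIJ.
- by split; [exact: jump_prod_subset|exact: jump_prod_mono].
- split; first exact: mass_prod_le_jump_prod.
  exact/jump_prod_mono/finset.subsetT.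
- exact: jump_prod_surjective.
Qed.
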